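(* Let $P$ be the Pascal automorphism of $(\mathbf{Z}_2,\mu)$ and $T$ the dyadic odometer $Tx=x+1$. Then for $\mu$-almost every $x\in\mathbf{Z}_2$ one has $$Px=x+n(x)=T^{n(x)}x,$$ where $n(x)$ is a nonnegative integer given explicitly as follows: if $x=0^m1^k10{*}{*}$ with $m,k\in\{0,1,2,\dots\}$ (that is, the sequence of dyadic digits of $x$ begins with $m$ zeros, then $k$ ones, then the pair $10$, where this pair is the first occurrence of $10$ in the sequence, and the remaining digits are arbitrary), then $$n(x)=2^m+2^k-1 .$$ Moreover, $$\int_{\mathbf{Z}_2} n(x)\,d\mu(x)=+\infty .$$
   Context: $\mathbf{Z}_2$ is the compact additive group of dyadic (2-adic) integers, identified with the space of infinite sequences $x=(x_0,x_1,x_2,\dots)$, $x_i\in\{0,1\}$, via $x=\sum_{i\ge 0}x_i2^i$; $\mu$ is the normalized Haar measure. The dyadic odometer is $T:\mathbf{Z}_2\to\mathbf{Z}_2$, $Tx=x+1$. The notation $0^m1^k10{*}{*}$ stands for a sequence whose initial digits, written in order $x_0x_1x_2\dots$, are $m$ zeros, then $k$ ones, then $1,0$, with arbitrary subsequent digits ${*}{*}$. The Pascal automorphism $P$ is the $\mu$-almost everywhere defined transformation of $\mathbf{Z}_2$ given by $$P(0^m1^k10{*}{*})=1^k0^m01{*}{*},\qquad m,k=0,1,2,\dots,$$ where the digits denoted ${*}{*}$ are unchanged. (In words: find the first appearance of the pair $10$, replace it by $01$, and rearrange the digits preceding it so that all ones come first, followed by all zeros.) *)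

(* Defs.v *)
From HB Require Import structures.
From mathcomp Require Import all_boot all_order all_algebra.
From mathcomp Require Import zify.
From mathcomp Require Import all_classical all_reals all_analysis.

Set Implicit Arguments.
Unset Strict Implicit.
Unset Printing Implicit Defensive.

Import Order.TTheory GRing.Theory Num.Theory.

Local Open Scope classical_set_scope.
Local Open Scope ring_scope.

(* A dyadic integer is given by its digits: x stands for the 2-adic sum of    *)
(* the x i * 2 ^ i (see dyadic_digits_cvg below), true being the digit 1.     *)
Definition dyadic : Type := nat -> bool.

HB.instance Definition _ := Choice.copy dyadic {ptws nat -> bool}.
HB.instance Definition _ := Pointed.copy dyadic {ptws nat -> bool}.
HB.instance Definition _ := Topological.copy dyadic {ptws nat -> bool}.

(* The residue of x modulo 2 ^ n. *)
Definition dyadic_res (x : dyadic) (n : nat) : nat :=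
  (\sum_(i < n) x i * 2 ^ i)%N.

(* The dyadic integer congruent to f n modulo 2 ^ n for all n; meaningful     *)
(* only when the residues f n are compatible.                                 *)
Definition dyadic_of_res (f : nat -> nat) : dyadic :=
  fun i => odd (f i.+1 %/ 2 ^ i)%N.

Section ring_structure.
Implicit Types (x y z : dyadic) (f g : nat -> nat).

Local Notation compat f := (forall n, f n.+1 = f n %[mod 2 ^ n]).

Definition dyadic_zero : dyadic := dyadic_of_res (fun=> 0%N).
Definition dyadic_one : dyadic := dyadic_of_res (fun=> 1%N).
Definition dyadic_add x y : dyadic :=
  dyadic_of_res (fun n => dyadic_res x n + dyadic_res y n)%N.
Definition dyadic_opp x : dyadic :=
  dyadic_of_res (fun n => 2 ^ n - dyadic_res x n)%N.
Definition dyadic_mul x y : dyadic :=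
  dyadic_of_res (fun n => dyadic_res x n * dyadic_res y n)%N.

Lemma dyadic_resS x n : dyadic_res x n.+1 = (dyadic_res x n + x n * 2 ^ n)%N.
Proof. by rewrite /dyadic_res big_ord_recr. Qed.

Lemma dyadic_res_lt x n : (dyadic_res x n < 2 ^ n)%N.
Proof.
elim: n => [|n IH]; first by rewrite /dyadic_res big_ord0.
by rewrite dyadic_resS expnS; case: (x n) => /=; lia.
Qed.

Lemma dyadic_res_compat x : compat (dyadic_res x).
Proof. by move=> n; rewrite dyadic_resS addnC modnMDl. Qed.

Lemma eq_dyadic_res x y n :
  dyadic_res x n = dyadic_res y n <-> forall i, (i < n)%N -> x i = y i.
Proof.
split; last by move=> xy; apply: eq_bigr => i _; rewrite xy.
elim: n => [//|n IH]; rewrite !dyadic_resS => xy i.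
have xyn : x n = y n.
  have := dyadic_res_lt x n; have := dyadic_res_lt y n; move: xy.
  by case: (x n) => /=; case: (y n) => //=; lia.
rewrite xyn in xy; move/addIn : xy => /IH {}IH.
by rewrite ltnS leq_eqVlt => /predU1P[->|/IH].
Qed.

Lemma dyadic_res_inj x y : (forall n, dyadic_res x n = dyadic_res y n) -> x = y.
Proof.
by move=> xy; apply/funext => i; have /eq_dyadic_res := xy i.+1; apply.
Qed.

Lemma dyadic_of_resK f n : compat f ->
  dyadic_res (dyadic_of_res f) n = (f n %% 2 ^ n)%N.
Proof.
move=> cf; elim: n => [|n IH]; first by rewrite /dyadic_res big_ord0 modn1.
rewrite dyadic_resS IH /dyadic_of_res -cf -modn2 modn_divl -expnS.
rewrite [RHS](divn_eq _ (2 ^ n)%N) addnC; congr (_ + _)%N.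
by rewrite modn_dvdm// expnS dvdn_mull.
Qed.

Lemma dyadic_res0 n : dyadic_res dyadic_zero n = 0%N.
Proof. by rewrite dyadic_of_resK// mod0n. Qed.

Lemma dyadic_res1 n : dyadic_res dyadic_one n = (1 %% 2 ^ n)%N.
Proof. by rewrite dyadic_of_resK. Qed.

Lemma dyadic_resD x y n :
  dyadic_res (dyadic_add x y) n =
  ((dyadic_res x n + dyadic_res y n) %% 2 ^ n)%N.
Proof.
rewrite dyadic_of_resK// => k.
by rewrite -modnDml -modnDmr !dyadic_res_compat modnDml modnDmr.
Qed.

Lemma dyadic_resN x n :
  dyadic_res (dyadic_opp x) n = ((2 ^ n - dyadic_res x n) %% 2 ^ n)%N.
Proof.
rewrite dyadic_of_resK// => k; rewrite dyadic_resS.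
have := dyadic_res_lt x k; case: (x k) => /=; rewrite expnS => xk.
  by congr (_ %% _)%N; lia.
rewrite mul0n addn0 -[RHS]modnDl; congr (_ %% _)%N; lia.
Qed.

Lemma dyadic_resM x y n :
  dyadic_res (dyadic_mul x y) n =
  ((dyadic_res x n * dyadic_res y n) %% 2 ^ n)%N.
Proof.
rewrite dyadic_of_resK// => k.
by rewrite -modnMml -modnMmr !dyadic_res_compat modnMml modnMmr.
Qed.

Let resE := (dyadic_res0, dyadic_res1, dyadic_resD, dyadic_resN, dyadic_resM).
Let res_small x n : (dyadic_res x n %% 2 ^ n)%N = dyadic_res x n.
Proof. by rewrite modn_small ?dyadic_res_lt. Qed.

Lemma dyadic_addA : associative dyadic_add.
Proof.
by move=> x y z; apply: dyadic_res_inj => n; rewrite !resE modnDmr modnDml addnA.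
Qed.

Lemma dyadic_addC : commutative dyadic_add.
Proof. by move=> x y; apply: dyadic_res_inj => n; rewrite !resE addnC. Qed.

Lemma dyadic_add0 : left_id dyadic_zero dyadic_add.
Proof. by move=> x; apply: dyadic_res_inj => n; rewrite !resE res_small. Qed.

Lemma dyadic_addN : left_inverse dyadic_zero dyadic_opp dyadic_add.
Proof.
move=> x; apply: dyadic_res_inj => n.
by rewrite !resE modnDml subnK ?modnn// ltnW// dyadic_res_lt.
Qed.

Lemma dyadic_mulA : associative dyadic_mul.
Proof.
by move=> x y z; apply: dyadic_res_inj => n; rewrite !resE modnMmr modnMml mulnA.
Qed.

Lemma dyadic_mulC : commutative dyadic_mul.
Proof. by move=> x y; apply: dyadic_res_inj => n; rewrite !resE mulnC. Qed.

Lemma dyadic_mul1 : left_id dyadic_one dyadic_mul.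
Proof.
by move=> x; apply: dyadic_res_inj => n; rewrite !resE modnMml mul1n res_small.
Qed.

Lemma dyadic_mulDl : left_distributive dyadic_mul dyadic_add.
Proof.
move=> x y z; apply: dyadic_res_inj => n.
by rewrite !resE modnMml modnDml modnDmr mulnDl.
Qed.

Lemma dyadic_1neq0 : dyadic_one != dyadic_zero.
Proof.
apply/eqP => /(congr1 (dyadic_res ^~ 1%N)).
by rewrite !resE.
Qed.

End ring_structure.

HB.instance Definition _ := GRing.isZmodule.Build dyadic
  dyadic_addA dyadic_addC dyadic_add0 dyadic_addN.
HB.instance Definition _ := GRing.Zmodule_isComNzRing.Build dyadic
  dyadic_mulA dyadic_mulC dyadic_mul1 dyadic_mulDl dyadic_1neq0.

Section topology.
Implicit Types x y : dyadic.

Lemma near_dyadic_digit x i : \forall y \near x, y i = x i.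
Proof.
have := @proj_continuous nat (fun=> bool) i x [set x i].
by apply; exact: discrete_set1.
Qed.

Lemma near_dyadic_res x n : \forall y \near x, dyadic_res y n = dyadic_res x n.
Proof.
elim: n => [|n IH].
  by apply: filterE => y; rewrite /dyadic_res !big_ord0.
near=> y; rewrite !dyadic_resS; congr (_ + _ * _)%N.
  by near: y.
by congr nat_of_bool; near: y; exact: near_dyadic_digit.
Unshelve. all: by end_near. Qed.

(* The topology is that of digitwise convergence. *)
Lemma cvg_dyadic (F : set_system dyadic) x : Filter F ->
  (forall n, \forall y \near F, dyadic_res y n = dyadic_res x n) -> F --> x.
Proof.
move=> FF Fx; apply/cvg_sup => i U [V] [[W] oW <-] Wx WU.
apply: filterS WU _; apply: filterS (Fx i.+1) => y /eq_dyadic_res yx.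
by rewrite /preimage/= yx.
Qed.

Lemma dyadic_sub_continuous : continuous (fun p : dyadic * dyadic => p.1 - p.2).
Proof.
move=> [x y]; apply: cvg_dyadic => n.
exists ([set x' | dyadic_res x' n = dyadic_res x n],
        [set y' | dyadic_res y' n = dyadic_res y n]).
  by split; exact: near_dyadic_res.
by move=> [x' y'] [/= xx' yy']; rewrite !dyadic_resD !dyadic_resN xx' yy'.
Qed.

HB.instance Definition _ :=
  PreTopologicalNmodule_isTopologicalZmodule.Build dyadic dyadic_sub_continuous.

Lemma dyadic_compact : compact [set: dyadic].
Proof. exact: cantor_space_compact. Qed.

Lemma dyadic_digits_cvg x :
  (\sum_(i < n) (x i)%:R * 2 ^+ i : dyadic) @[n --> \oo] --> x.
Proof.
have res2 i n : dyadic_res ((1 + 1) ^+ i) n = (2 ^ i %% 2 ^ n)%N.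
  elim: i => [|i IH]; first exact: dyadic_res1.
  rewrite exprS dyadic_resM dyadic_resD dyadic_res1 IH.
  by rewrite modnMmr modnMml -modnMml modnDml modnDmr modnMml expnS.
have resS k n : dyadic_res (\sum_(i < k) (x i)%:R * 2 ^+ i) n =
    (dyadic_res x k %% 2 ^ n)%N.
  elim: k => [|k IH].
    have -> : dyadic_res x 0 = 0%N by rewrite /dyadic_res big_ord0.
    by rewrite big_ord0 mod0n; exact: dyadic_res0.
  rewrite big_ord_recr/= dyadic_resD IH dyadic_resS modnDml.
  case: (x k) => /=; first by rewrite mul1r res2 modnDmr mul1n.
  by rewrite mul0r !addn0 (dyadic_res0 n) addn0.
apply: cvg_dyadic => n; exists n => //= k /= nk.
rewrite resS; elim: k nk => [|k IH].
  by rewrite leqn0 => /eqP ->; rewrite modn1 /dyadic_res big_ord0.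
rewrite leq_eqVlt => /predU1P[->|nk]; first by rewrite modn_small// dyadic_res_lt.
rewrite dyadic_resS -modnDmr -(modnMmr (x k)).
by move/eqP: (@dvdn_exp2l 2 n k nk) => ->; rewrite muln0 mod0n addn0 IH.
Qed.

End topology.

(* The Borel sigma-algebra. *)
HB.instance Definition _ := @isMeasurable.Build (sigma_display (@open dyadic))
  dyadic <<s @open dyadic >> (@sigma_algebra0 _ setT _)
  (@sigma_algebraC dyadic (@open dyadic)) (@sigma_algebra_bigcup _ setT _).

(* mu is the normalized Haar measure; it is a probability by its type.        *)
Definition haar (R : realType) (mu : probability dyadic R) : Prop :=
  forall (a : dyadic) (A : set dyadic), measurable A ->
    mu [set a + x | x in A] = mu A.

Definition odometer (x : dyadic) : dyadic := x + 1.

(* The sequence starting with the digits s, followed by those of w. *)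
Definition dyadic_cat (s : seq bool) (w : dyadic) : dyadic :=
  fun i => nth (w (i - size s)%N) s i.

(* The sequence 0^m 1^k 1 0 w. *)
Definition pascal_src (m k : nat) (w : dyadic) : dyadic :=
  dyadic_cat (nseq m false ++ nseq k true ++ [:: true; false]) w.

(* The sequence 1^k 0^m 0 1 w. *)
Definition pascal_tgt (m k : nat) (w : dyadic) : dyadic :=
  dyadic_cat (nseq k true ++ nseq m false ++ [:: false; true]) w.

(* The Pascal automorphism, extended by the identity to the sequences in      *)
(* which 10 does not occur.                                                   *)
Definition pascal (x : dyadic) : dyadic :=
  xget x [set y | exists m k w, x = pascal_src m k w /\ y = pascal_tgt m k w].

Lemma pascal_src_digit m k w i : pascal_src m k w i =
  if (i < m)%N then false else if (i < m + k.+1)%N then true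
  else if i == (m + k.+1)%N then false else w (i - (m + k.+2))%N.
Proof.
rewrite /pascal_src /dyadic_cat !nth_cat !size_cat !size_nseq /= !nth_nseq.
have -> : (m + (k + 2) = m + k.+2)%N by rewrite addn2.
case: ltnP => // mi; case: ltnP => ik.
  by rewrite ifT//; lia.
case: ltnP => ik1.
  by have -> : (i - m - k = 0)%N by lia.
case: eqP => [->|ik2]; first by have -> : (m + k.+1 - m - k = 1)%N by lia.
have -> : (i - m - k = (i - (m + k.+2)).+2)%N by lia.
by rewrite /= nth_nil.
Qed.

Lemma pascal_src_inj m k w m' k' w' : pascal_src m k w = pascal_src m' k' w' ->
  [/\ m = m', k = k' & w = w'].
Proof.
move=> e; have {}e i := congr1 (fun x : dyadic => x i) e.
have mm : m = m'.
  move: (e m) (e m'); rewrite !pascal_src_digit !ltnn.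
  rewrite -[X in (X < _)%N]addn0 ltn_add2l /= -[X in (X < m' + _)%N]addn0.
  by do !case: ifP => //; lia.
rewrite -{m'}mm in e *; have kk : k = k'.
  move: (e (m + k.+1)%N) (e (m + k'.+1)%N); rewrite !pascal_src_digit.
  by do !case: ifP => //; lia.
rewrite -{k'}kk in e *; split=> //; apply/funext => i.
move: (e (m + k.+2 + i)%N); rewrite !pascal_src_digit addKn.
by do !case: ifP => //; lia.
Qed.

Lemma pascalE m k w : pascal (pascal_src m k w) = pascal_tgt m k w.
Proof.
rewrite /pascal; case: xgetP => [y _ [m' [k' [w' [/pascal_src_inj]]]]|].
  by case=> -> -> ->.
by move/(_ (pascal_tgt m k w)); case; exists m, k, w.
Qed.

(* Main.v *)
Require Import Defs.
From HB Require Import structures.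
From mathcomp Require Import all_boot all_order all_algebra.
From mathcomp Require Import zify lra.
From mathcomp Require Import all_classical all_reals all_analysis.
From mathcomp Require Import measurable_realfun.

Set Implicit Arguments.
Unset Strict Implicit.
Unset Printing Implicit Defensive.

Import Order.TTheory GRing.Theory Num.Theory.

Local Open Scope classical_set_scope.
Local Open Scope ring_scope.

(** Write [x = 0^m 1^(k+1) 0 w] with [v] for the value of [w].  Then
    [x = 2^m (2^(k+1) - 1) + 2^(m+k+2) v], whereas
    [P x = 1^k 0^(m+1) 1 w = (2^k - 1) + 2^(m+k+1) + 2^(m+k+2) v], so that
    [P x - x = 2^m + 2^k - 1] ([pascal_tgt_add]).  The computation is
    carried out on natural numbers, with residues of [w] in place of [v], since
    the residues modulo large powers of 2 determine a dyadic integer.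

    Translation invariance and additivity force the Haar measure of a residue
    class modulo [2^n] to be [2^-n] ([haar_dyadic_ball]): the classes are
    translates of one another, and each is the disjoint union of two classes
    modulo [2^(n+1)].  A point lies in classes of arbitrarily small measure, so
    countable sets are null.  The sequences without an occurrence of 10 are
    [0^oo] and the [0^m 1^oo], hence form a countable set
    ([setC_pascal_domain]), which gives the formula almost everywhere.

    The integral diverges already because of [k = 0]: on the cylinder
    [0^m 1 0 w], of measure [2^-(m+2)], the time is [2^m], so that each of these
    disjoint cylinders contributes 1/4 ([integral_pascal_time_cylinder]). *)

(** * The displacement as an identity of residues *)

Lemma dyadic0E i : (0 : dyadic) i = false.
Proof.
by rewrite -[0 : dyadic]/dyadic_zero /dyadic_zero /dyadic_of_res div0n.
Qed.

Lemma dyadic_res_natr (c n : nat) : dyadic_res c%:R n = (c %% 2 ^ n)%N.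
Proof.
elim: c => [|c IH]; first by rewrite mod0n; exact: dyadic_res0.
by rewrite -addn1 natrD dyadic_resD IH dyadic_res1 modnDml modnDmr.
Qed.

(** The binary expansion as a Horner scheme: a block prepended to a sequence
    acts on the residues by an affine map, computed for constant blocks in the
    next two lemmas. *)
Lemma dyadic_res_cat s w j : dyadic_res (dyadic_cat s w) (size s + j) =
  foldr (fun (b : bool) v => b + v.*2)%N (dyadic_res w j) s.
Proof.
elim: s => [|b s IH] /=.
  by apply/eq_dyadic_res => i _; rewrite /dyadic_cat nth_nil subn0.
rewrite -IH /dyadic_res big_ord_recl/= muln1; congr (_ + _)%N.
rewrite -mul2n big_distrr/=; apply: eq_bigr => i _.
by rewrite /bump/= add1n expnS mulnCA.
Qed.

Lemma foldr_nseq_false v m :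
  foldr (fun (b : bool) v => b + v.*2)%N v (nseq m false) = (2 ^ m * v)%N.
Proof. by elim: m => [|m /= ->]; rewrite ?mul1n// expnS; lia. Qed.

Lemma foldr_nseq_true v k :
  foldr (fun (b : bool) v => b + v.*2)%N v (nseq k true) =
  (2 ^ k * v.+1 - 1)%N.
Proof.
elim: k => [|k /= ->]; first by rewrite mul1n subn1.
rewrite expnS; have := expn_gt0 2 k; nia.
Qed.

(** The increment is the same for all tails [w] since source and target have
    prefixes of the same length, with values [2^m (2^(k+1) - 1)] and
    [2^k - 1 + 2^(m+k+1)]. *)
Lemma pascal_tgt_add m k w :
  pascal_tgt m k w = pascal_src m k w + (2 ^ m + 2 ^ k - 1)%:R.
Proof.
apply: dyadic_res_inj => n.
(* Residues modulo larger powers of 2 suffice; there the prefix of length     *)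
(* m + k + 2 splits off.                                                      *)
suff e : dyadic_res (pascal_tgt m k w) (m + k + 2 + n) =
    dyadic_res (pascal_src m k w + (2 ^ m + 2 ^ k - 1)%:R) (m + k + 2 + n).
  apply/eq_dyadic_res => i lt_i_n.
  by apply: (iffLR (eq_dyadic_res _ _ _) e); rewrite ltn_addl.
rewrite dyadic_resD dyadic_res_natr modnDmr.
rewrite -[LHS](modn_small (dyadic_res_lt _ _)).
(* No reduction occurs in the sum: the two residues differ exactly by the     *)
(* displacement.                                                              *)
congr (_ %% _)%N.
rewrite [X in dyadic_res (pascal_tgt _ _ _) X](_ : _ =
    size (nseq k true ++ nseq m false ++ [:: false; true]) + n)%N; last first.
  by rewrite !size_cat !size_nseq/=; lia.
rewrite [X in dyadic_res (pascal_src _ _ _) X](_ : _ =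
    size (nseq m false ++ nseq k true ++ [:: true; false]) + n)%N; last first.
  by rewrite !size_cat !size_nseq/=; lia.
rewrite !dyadic_res_cat !foldr_cat !foldr_nseq_false !foldr_nseq_true/=.
have := expn_gt0 2 k; have := expn_gt0 2 m.
move: (dyadic_res w n) (2 ^ m)%N (2 ^ k)%N => v a b; nia.
Qed.

Lemma iter_odometer n x : iter n odometer x = x + n%:R.
Proof.
by elim: n => [|n IH]; rewrite ?addr0// iterS IH /odometer mulrSr addrA.
Qed.

(** * Occurrences of 10 *)

(** A digit 1 followed at any distance by a digit 0 forces an occurrence of 10:
    take the first 1, at [m], and the first 0 after it, at [l]; the block of
    ones has length [l - m = k + 1], its last one opening the pair. *)
Lemma pascal_src_exists (x : dyadic) i j : (i < j)%N -> x i -> ~~ x j ->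
  exists m k w, x = pascal_src m k w.
Proof.
move=> ij xi xj; have exm : exists m, x m by exists i.
case: (ex_minnP exm) => m xm min_m.
have mi : (m <= i)%N by exact: min_m.
have exl : exists l, (m <= l)%N && ~~ x l by exists j; rewrite xj andbT; lia.
case: (ex_minnP exl) => l /andP[ml xl] min_l.
have {}ml : (m < l)%N by rewrite ltn_neqAle ml andbT; apply: contraNneq xl => <-.
exists m, (l - m.+1)%N, (fun n => x (l.+1 + n)%N); apply/funext => n.
rewrite pascal_src_digit.
have -> : (m + (l - m.+1).+1 = l)%N by lia.
have -> : (m + (l - m.+1).+2 = l.+1)%N by lia.
case: ltnP => nm; first by apply/negP => /min_m; lia.
case: ltnP => nl.
  by apply/negPn/negP => xn; have := min_l n; rewrite nm xn => /(_ isT); lia.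
by case: eqP => [->|nl']; [exact/negbTE | congr (x _); lia].
Qed.

(** * Haar measure of residue classes and points *)

(** The residue class of [y] modulo [2^n], a ball of the 2-adic metric. *)
Definition dyadic_ball (n : nat) (y : dyadic) : set dyadic :=
  [set x | dyadic_res x n = dyadic_res y n].

Lemma dyadic_ball_digit n y x :
  dyadic_ball n y x <-> forall i, (i < n)%N -> x i = y i.
Proof. exact: eq_dyadic_res. Qed.

Lemma measurable_dyadic_ball n y : measurable (dyadic_ball n y).
Proof.
apply: sub_sigma_algebra; rewrite openE => x /= xy.
rewrite /interior; near=> z; rewrite /dyadic_ball/= -xy.
by near: z; exact: near_dyadic_res.
Unshelve. all: by end_near. Qed.

Lemma dyadic_ball_translate n y :
  dyadic_ball n y = [set y + x | x in dyadic_ball n 0].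
Proof.
rewrite /dyadic_ball; apply/seteqP; split => x /=.
  move=> xy; exists (x - y); last by rewrite addrC subrK.
  have -> : 0 = y - y by rewrite subrr.
  by rewrite !dyadic_resD xy.
by move=> [z z0 <-]; rewrite -[in RHS](addr0 y) !dyadic_resD z0.
Qed.

(** The second class is that of [2^n], whose only digit 1 is the one of index
    [n]. *)
Lemma dyadic_ball_split n :
  dyadic_ball n 0 = dyadic_ball n.+1 0 `|` dyadic_ball n.+1 (fun i => i == n).
Proof.
apply/seteqP; split => [x /dyadic_ball_digit x0|x].
  case: (boolP (x n)) => xn; [right|left]; apply/dyadic_ball_digit => i;
    rewrite ltnS leq_eqVlt => /predU1P[->|lt_in].
  - by rewrite eqxx.
  - by rewrite x0// dyadic0E ltn_eqF.
  - by rewrite dyadic0E; apply/negbTE.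
  - exact: x0.
by case=> /dyadic_ball_digit xd; apply/dyadic_ball_digit => i lt_in;
  rewrite xd 1?ltnW// ?ltn_eqF// dyadic0E.
Qed.

Section haar_ball.
Variables (R : realType) (mu : probability dyadic R) (mu_haar : haar mu).

(** Both halves of the class of 0 have the same measure, being translates of
    one another, so the measure halves at each step from [mu setT = 1]. *)
Lemma haar_dyadic_ball n y : mu (dyadic_ball n y) = (2^-1 ^+ n)%:E.
Proof.
have trans k z : mu (dyadic_ball k z) = mu (dyadic_ball k 0).
  rewrite dyadic_ball_translate; apply: mu_haar.
  exact: measurable_dyadic_ball.
rewrite trans; elim: n {y} => [|n IH].
  rewrite expr0 -(probability_setT mu); congr (mu _).
  by apply/seteqP; split => // x _; apply/dyadic_ball_digit.
move: IH; rewrite dyadic_ball_split measureU; last 3 first.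
- exact: measurable_dyadic_ball.
- exact: measurable_dyadic_ball.
- apply/seteqP; split => // x [] /dyadic_ball_digit x0 /dyadic_ball_digit x1.
  by have := x0 n (ltnSn n); rewrite x1// eqxx dyadic0E.
rewrite [X in (_ + X)%R]trans.
have : mu (dyadic_ball n.+1 0) \is a fin_num.
  by apply: fin_num_measure; exact: measurable_dyadic_ball.
move=> /fineK; set r := fine _ => rE Er.
have e : r + r = 2^-1 ^+ n by apply: EFin_inj; rewrite EFinD rE.
by rewrite -[LHS]rE exprS -e; congr EFin; lra.
Qed.

(** [y] lies in a class of measure [2^-n] for every [n]. *)
Lemma haar_set1_negligible y : mu.-negligible [set y].
Proof.
have y_ball : [set y] = \bigcap_n dyadic_ball n y.
  apply/seteqP; split => [x -> //|x xy].
  by apply: dyadic_res_inj => n; exact: xy.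
have my : measurable [set y].
  rewrite y_ball; apply: bigcapT_measurable => n.
  exact: measurable_dyadic_ball.
have le_n n : (mu [set y] <= (2^-1 ^+ n)%:E)%E.
  rewrite -(haar_dyadic_ball n y); apply: le_measure; rewrite ?inE//.
    exact: measurable_dyadic_ball.
  by rewrite y_ball; exact: bigcap_inf.
suff mu0 : mu [set y] = 0%E by exact/negligibleP.
have : mu [set y] \is a fin_num by exact: fin_num_measure.
move=> /fineK; set r := fine _ => rE; rewrite -rE.
have r_ge0 : 0 <= r by exact: fine_ge0.
congr EFin; apply/eqP; rewrite eq_le r_ge0 andbT leNgt; apply/negP => r_gt0.
have rV_ge0 : 0 <= r^-1 by rewrite invr_ge0.
(* For r^-1 < M, the bound r <= 2^-M contradicts M < 2^M.                     *)
have := archi_boundP rV_ge0; set M := Num.bound _; apply/negP; rewrite -leNgt.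
have := le_n M; rewrite -rE lee_fin exprVn => r_le.
apply: (@le_trans _ _ (2 ^+ M)).
  by rewrite -natrX ler_nat ltnW// ltn_expl.
by rewrite -[leLHS]invrK lef_pV2 ?posrE ?invr_gt0 ?exprn_gt0 ?ltr0n.
Qed.

End haar_ball.

(** * The time function *)

(** The choice of parameters is harmless as [pascal_src] is injective; the
    value 0 where 10 does not occur makes the function constant on that null
    set, hence measurable everywhere. *)
Definition pascal_time (x : dyadic) : nat :=
  xget 0%N [set p | exists m k w,
    x = pascal_src m k w /\ p = (2 ^ m + 2 ^ k - 1)%N].

Lemma pascal_timeE m k w :
  pascal_time (pascal_src m k w) = (2 ^ m + 2 ^ k - 1)%N.
Proof.
rewrite /pascal_time; case: xgetP => [p _ [m' [k' [w' [/pascal_src_inj]]]]|].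
  by case=> -> -> _.
by move/(_ (2 ^ m + 2 ^ k - 1)%N); case; exists m, k, w.
Qed.

Definition pascal_cylinder m k : set dyadic :=
  [set x | exists w, x = pascal_src m k w].

(** The first [m + k + 2] digits decide membership; the tail is free, and the
    tail 0 provides a representative. *)
Lemma pascal_cylinderE m k :
  pascal_cylinder m k = dyadic_ball (m + k.+2) (pascal_src m k 0).
Proof.
apply/seteqP; split => [x [w ->]|x /dyadic_ball_digit xd].
  apply/dyadic_ball_digit => i lt_i; rewrite !pascal_src_digit.
  by do !case: ifP => //; lia.
exists (fun i => x (m + k.+2 + i)%N); apply/funext => i.
case: (ltnP i (m + k.+2)) => lt_i.
  by rewrite xd// !pascal_src_digit; do !case: ifP => //; lia.
by rewrite pascal_src_digit !ifF ?subnKC//; lia.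
Qed.

Lemma measurable_pascal_cylinder m k : measurable (pascal_cylinder m k).
Proof. by rewrite pascal_cylinderE; exact: measurable_dyadic_ball. Qed.

Definition pascal_domain : set dyadic :=
  \bigcup_m \bigcup_k pascal_cylinder m k.

Lemma pascal_domainP x :
  pascal_domain x <-> exists m k w, x = pascal_src m k w.
Proof.
split=> [[m _ [k _ [w ->]]]|[m [k [w ->]]]]; first by exists m, k, w.
by exists m => //; exists k => //; exists w.
Qed.

Lemma measurable_pascal_domain : measurable pascal_domain.
Proof.
apply: bigcupT_measurable => m; apply: bigcupT_measurable => k.
exact: measurable_pascal_cylinder.
Qed.

Lemma pascal_timeN x : ~ pascal_domain x -> pascal_time x = 0%N.
Proof.
move=> xD; rewrite /pascal_time; case: xgetP => // p _ [m [k [w [xE _]]]].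
by case: xD; apply/pascal_domainP; exists m, k, w.
Qed.

(** Without an occurrence of 10, the digits are all 1 from the first 1 on. *)
Lemma setC_pascal_domain :
  ~` pascal_domain `<=`
    [set (0 : dyadic)] `|` \bigcup_m [set (fun i => m <= i)%N : dyadic].
Proof.
move=> x xD; have [x0|nx0] := pselect (forall i, x i = false); [left|right].
  by apply/funext => i; rewrite x0 dyadic0E.
have [i /eqP] := iffRL (existsNP _) nx0; rewrite eqbF_neg negbK => xi.
have exm : exists m, x m by exists i.
case: (ex_minnP exm) => m xm min_m; exists m => //; apply/funext => j.
case: leqP => mj; last by apply/negbTE/negP => /min_m; rewrite leqNgt mj.
apply/negPn/negP => xj; apply: xD; apply/pascal_domainP.
apply: (pascal_src_exists _ xm xj); rewrite ltn_neqAle mj andbT.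
by apply: contraNneq xj => <-.
Qed.

(** * Divergence of the integral *)

Section integral.
Variables (R : realType) (mu : probability dyadic R) (mu_haar : haar mu).

(** The function is constant on each of the countably many cylinders and on
    the complement of their union. *)
Lemma measurable_pascal_time :
  measurable_fun [set: dyadic]
    ((fun x => (pascal_time x)%:R%:E) : dyadic -> \bar R).
Proof.
rewrite -(setUv pascal_domain); apply/measurable_funU.
- exact: measurable_pascal_domain.
- by apply: measurableC; exact: measurable_pascal_domain.
split.
  apply/measurable_fun_bigcup => m.
    by apply: bigcupT_measurable => k; exact: measurable_pascal_cylinder.
  apply/measurable_fun_bigcup => k; first exact: measurable_pascal_cylinder.
  apply: (eq_measurable_fun (cst ((2 ^ m + 2 ^ k - 1)%N%:R : R)%:E)) => //.
  by move=> x; rewrite inE => -[w ->]; rewrite pascal_timeE.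
apply: (eq_measurable_fun (cst (0 : R)%:E)) => //.
by move=> x; rewrite inE => /pascal_timeN ->.
Qed.

(** For [k = 0] the time is [2^m + 2^0 - 1 = 2^m], and the measure of the
    cylinder is [2^-(m+2)]. *)
Lemma integral_pascal_time_cylinder m :
  (\int[mu]_(x in pascal_cylinder m 0) ((pascal_time x)%:R)%:E)%E =
  (4^-1)%:E.
Proof.
rewrite (eq_integral (cst ((2 ^ m)%N%:R : R)%:E)); last first.
  by move=> x; rewrite inE => -[w ->]; rewrite pascal_timeE expn0 addnK.
transitivity (((2 ^ m)%N%:R)%:E * mu (pascal_cylinder m 0))%E.
  by apply: integral_cst; exact: measurable_pascal_cylinder.
rewrite pascal_cylinderE haar_dyadic_ball// -EFinM; congr EFin.
rewrite natrX exprD mulrA -exprMn divff// expr1n; lra.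
Qed.

Lemma integral_pascal_time :
  (\int[mu]_(x in [set: dyadic]) ((pascal_time x)%:R)%:E)%E = +oo%E.
Proof.
have mC m := @measurable_pascal_cylinder m 0.
have mD : measurable (\bigcup_m pascal_cylinder m 0).
  exact: bigcupT_measurable.
apply/eqyP => A A_gt0.
apply: (@le_trans _ _
  (\int[mu]_(x in \bigcup_m pascal_cylinder m 0) ((pascal_time x)%:R)%:E)%E);
  last first.
  apply: ge0_subset_integral => //; exact: measurable_pascal_time.
rewrite ge0_integral_bigcup//; last 2 first.
- by apply: measurable_funS measurable_pascal_time.
- apply/trivIsetP => m m' _ _ /eqP neq_mm'; apply/seteqP; split => // x.
  by case=> -[w ->] [w' /pascal_src_inj[/neq_mm']].
(* More than 4 A terms equal to 1/4 add up to more than A.                    *)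
pose M := Num.bound (4 * A).
apply: le_trans (nneseries_lim_ge M _); last first.
  by move=> m _ _; apply: integral_ge0.
under eq_bigr do rewrite integral_pascal_time_cylinder.
rewrite sumEFin lee_fin sumr_const_nat subn0 -mulr_natr.
have : 0 <= 4 * A by rewrite mulr_ge0// ltW.
by move/archi_boundP; rewrite -/M => AM; lra.
Qed.

End integral.

Theorem mainTheorem1 (R : realType) (mu : probability dyadic R)
    (mu_haar : haar mu) :
  exists n : dyadic -> nat,
    [/\ forall (m k : nat) (w : dyadic),
          n (pascal_src m k w) = (2 ^ m + 2 ^ k - 1)%N,
        {ae mu, forall x : dyadic,
          [/\ exists m k w, x = pascal_src m k w,
              pascal x = x + (n x)%:R &
              pascal x = iter (n x) odometer x]}
      & (\int[mu]_(x in [set: dyadic]) ((n x)%:R)%:E)%E = +oo%E].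
Proof.
exists pascal_time; split.
- exact: pascal_timeE.
- apply: (@negligibleS _ _ _ _
    ([set (0 : dyadic)] `|` \bigcup_m [set (fun i => m <= i)%N : dyadic]));
    last first.
    apply: negligibleU; first exact: haar_set1_negligible.
    by apply: negligible_bigcup => m; exact: haar_set1_negligible.
  move=> x nx; apply: setC_pascal_domain => /pascal_domainP xD; apply: nx.
  have [m [k [w xE]]] := xD.
  have px : pascal x = x + (pascal_time x)%:R.
    by rewrite xE pascalE pascal_timeE pascal_tgt_add.
  by split; rewrite ?iter_odometer.
- exact: integral_pascal_time.
Qed.
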